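(* Fix $\alpha\in\{\text{rotor routing},\ \text{Bernardi}\}$, and for a ribbon graph $(H,\sigma)$ and $u\in V(H)$ write $\alpha_u^{H}$ for the corresponding sandpile torsor with basepoint $u$. There exist ribbon graphs $(G,\rho)$ and $(G',\rho')$ of genera $g\neq g'$ with $V(G)=V(G')$, a subset $V_{gen}\subseteq V(G)$ satisfying Properties 1 and 2 below, and a bijection $\varphi:\mathcal T(G)\to\mathcal T(G')$ such that, with $\hat\gamma:\operatorname{Pic}^0(G)\to\operatorname{Pic}^0(G')$ the isomorphism induced by the identity on $V_{gen}$, for every $v\in V(G)$, $S\in\operatorname{Pic}^0(G)$, $T\in\mathcal T(G)$: $$\varphi\big(\alpha_v^{G}(S,T)\big)=\alpha_v^{G'}\big(\hat\gamma(S),\varphi(T)\big).$$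
   Context: Graphs are finite and connected, may have multiple edges, and have no loops. $\mathcal T(G)$ is the set of spanning trees (subsets of $E(G)$). A ribbon graph $(G,\rho)$ assigns to each vertex $u$ a cyclic order $\rho_u$ on the edges incident to $u$. $\operatorname{Div}^0(G)$: integer chip configurations of total degree 0; firing $u$ moves one chip from $u$ along each incident edge; $\operatorname{Pic}^0(G)$ is $\operatorname{Div}^0(G)$ modulo the subgroup generated by firings (the image of the Laplacian); $\operatorname{Pic}^k(G)$ is defined likewise for degree $k$. For graphs $G,G'$ on the same vertex set and $V_{gen}\subseteq V(G)$: Property 1: every element of $\operatorname{Pic}^0(G)$ and every element of $\operatorname{Pic}^0(G')$ has a representative with no chips outside $V_{gen}$. Property 2: two degree-zero configurations with no chips outside $V_{gen}$ are equivalent in $G$ iff they are equivalent in $G'$. Then $\hat\gamma(S)$ is defined by choosing a representative of $S$ supported on $V_{gen}$ and taking its class in $\operatorname{Pic}^0(G')$ (same chip counts on each vertex). Rotor routing torsor $r_v$: for $S\in\operatorname{Pic}^0(G)$, $T\in\mathcal T(G)$, choose a representative of $S$ nonnegative away from $v$; orient $T$ towards $v$ so each $u\ne v$ has an outgoing edge (rotor). While some $u\neq v$ has positive chips, advance the rotor at $u$ to the next edge of $\rho_u$ and send a chip from $u$ along it. When all vertices other than $v$ have zero chips, the rotors form the spanning tree $r_v(S,T)$ (well defined; a free transitive action). Bernardi torsor $\beta_v$: with half-edges $(e,u)$ for $u$ an endpoint of $e$, for $T\in\mathcal T(G)$ start at $(e_0,v)$ for a fixed edge $e_0$ at $v$;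 at $(e',v')$: if $e'\in T$ with other endpoint $w'$, move to $(e'',w')$, $e''$ following $e'$ in $\rho_{w'}$; if $e'\notin T$, move to $(\tilde e,v')$, $\tilde e$ following $e'$ in $\rho_{v'}$, placing a chip on $v'$ if the other half-edge of $e'$ was not yet visited. Stop on returning to $(e_0,v)$. The resulting divisors $D_T$ of degree $k=|E|-|V|+1$ give a bijection $T\mapsto[D_T]\in\operatorname{Pic}^k(G)$, and $\beta_v(S,T)$ is the unique $T'$ with $[D_{T'}]=[D_T]+S$. Genus: a cycle of $(G,\rho)$ is a closed walk that, on entering $u$ along $e$, leaves along the edge following $e$ in $\rho_u$; with $\operatorname{cyc}(G,\rho)$ the number of cycles, the genus $g$ satisfies $2g=2-|V(G)|+|E(G)|-\operatorname{cyc}(G,\rho)$. *)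

(* Defs.v *)
From Stdlib Require Import Relations.Relation_Operators.
From HB Require Import structures.
From mathcomp Require Import all_boot all_order all_algebra.
Set Implicit Arguments. Unset Strict Implicit. Unset Printing Implicit Defensive.
Import GRing.Theory Num.Theory.
Local Open Scope ring_scope.

(* A multigraph on vertex type V with edge type [edge], endpoint map [ends],
   together with a rotation [rot u] : the successor of an edge in the cyclic
   order rho_u on the edges incident to u (values outside irrelevant). *)
Record ribbon_graph (V : finType) := RibbonGraph {
  edge : finType;
  ends : edge -> V * V;
  rot : V -> edge -> edge }.

Arguments edge {V} G : rename.
Arguments ends {V} G _ : rename.
Arguments rot {V} G _ _ : rename.

Inductive torsor_kind := RotorRouting | Bernardi.

Unset Implicit Arguments.
Section Defs.
Variables (V : finType) (G : ribbon_graph V).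
Local Notation E := (edge G).

Definition incident (u : V) (e : E) : bool :=
  ((ends G e).1 == u) || ((ends G e).2 == u).

Definition other (e : E) (u : V) : V :=
  if (ends G e).1 == u then (ends G e).2 else (ends G e).1.

Definition adj_in (A : {set E}) : rel V :=
  fun x y => [exists e in A, incident x e && (y == other e x)].

Definition connected_in (A : {set E}) : Prop :=
  forall x y : V, connect (adj_in A) x y.

Definition is_ribbon_graph : Prop :=
  (forall e : E, (ends G e).1 != (ends G e).2) /\
  connected_in setT /\
  (forall u : V,
     (forall e, incident u e -> incident u (rot G u e)) /\
     (forall e f, incident u e -> incident u f -> rot G u e = rot G u f -> e = f) /\
     (forall e f, incident u e -> incident u f -> fconnect (rot G u) e f)).

Definition spanning_tree (T : {set E}) : Prop :=
  connected_in T /\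
  (forall e, e \in T -> ~ connect (adj_in (T :\ e)) (ends G e).1 (ends G e).2).

Definition deg (D : V -> int) : int := \sum_(u : V) D u.

Definition supported (A : {set V}) (D : V -> int) : Prop :=
  forall u, u \notin A -> D u = 0.

(* D1 - D2 lies in the subgroup generated by firings (image of Laplacian) *)
Definition lin_equiv (D1 D2 : V -> int) : Prop :=
  exists f : V -> int, forall w : V,
    D1 w - D2 w = \sum_(e : E | incident w e) (f w - f (other e w)).

Definition darts : pred (E * V) := fun x => incident x.2 x.1.
(* dart (e,w) = "arrived at w along e"; leave along the next edge of rho_w *)
Definition facemap (x : E * V) : E * V :=
  let e' := rot G x.2 x.1 in (e', other e' x.2).
Definition cyc : nat := fcard facemap darts.
Definition genus : nat := ((2 + #|E|) - (#|V| + cyc))%N./2.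

Definition rr_step (v : V) (s s' : (V -> int) * (V -> E)) : Prop :=
  exists u : V,
    u != v /\ 0 < s.1 u /\
    (forall w, s'.2 w = if w == u then rot G u (s.2 u) else s.2 w) /\
    (forall w, s'.1 w = s.1 w - (nat_of_bool (w == u))%:Z
                        + (nat_of_bool (w == other (s'.2 u) u))%:Z).

Definition oriented_to (T : {set E}) (v : V) (r : V -> E) : Prop :=
  forall u, u != v ->
    r u \in T /\ incident u (r u) /\
    connect (fun x y => (x != v) && (y == other (r x) x)) u v.

Definition rotor_torsor (v : V) (D : V -> int) (T T' : {set E}) : Prop :=
  exists (D0 : V -> int) (r0 : V -> E) (cf : V -> int) (rf : V -> E),
    lin_equiv D0 D /\ (forall u, u != v -> 0 <= D0 u) /\
    oriented_to T v r0 /\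
    clos_refl_trans _ (rr_step v) (D0, r0) (cf, rf) /\
    (forall u, u != v -> cf u = 0) /\
    T' = [set rf u | u in [set~ v]].

(* Bernardi tour; half-edge (e,u) = e seen from its endpoint u *)
Fixpoint bwalk (T : {set E}) (start : E * V) (n : nat) (cur : E * V)
    (vis : seq (E * V)) (D : V -> int) : V -> int :=
  match n with
  | 0%N => D
  | n'.+1 =>
    let e := cur.1 in let u := cur.2 in
    let nxtD :=
      if e \in T then ((rot G (other e u) e, other e u), D)
      else ((rot G u e, u),
            if (e, other e u) \in vis then D
            else fun w => D w + (nat_of_bool (w == u))%:Z) in
    if nxtD.1 == start then nxtD.2
    else bwalk T start n' nxtD.1 (nxtD.1 :: vis) nxtD.2
  end.

Definition bernardi_div (T : {set E}) (v : V) (e0 : E) : V -> int :=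
  bwalk T (e0, v) (2 * #|E|).+1 (e0, v) [:: (e0, v)] (fun _ => 0).

Definition bernardi_rel (v : V) (e0 : E) (D : V -> int) (T T' : {set E}) : Prop :=
  lin_equiv (bernardi_div T' v e0) (fun w => bernardi_div T v e0 w + D w).

Definition torsor (k : torsor_kind) (v : V) (D : V -> int) (T T' : {set E}) : Prop :=
  match k with
  | RotorRouting => rotor_torsor v D T T'
  | Bernardi => forall e0, incident v e0 -> bernardi_rel v e0 D T T'
  end.

End Defs.
Arguments incident {V} G.
Arguments other {V} G.
Arguments adj_in {V} G.
Arguments connected_in {V} G.
Arguments is_ribbon_graph {V} G.
Arguments spanning_tree {V} G.
Arguments lin_equiv {V} G.
Arguments darts {V} G.
Arguments facemap {V} G.
Arguments cyc {V} G.
Arguments genus {V} G.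
Arguments rr_step {V} G.
Arguments oriented_to {V} G.
Arguments rotor_torsor {V} G.
Arguments bwalk {V} G.
Arguments bernardi_div {V} G.
Arguments bernardi_rel {V} G.
Arguments torsor {V} G.
Arguments deg {V}.
Arguments supported {V}.
Set Implicit Arguments.

Definition property1 (V : finType) (G G' : ribbon_graph V) (Vgen : {set V}) : Prop :=
  (forall D : V -> int, deg D = 0 -> exists D', supported Vgen D' /\ lin_equiv G D D') /\
  (forall D : V -> int, deg D = 0 -> exists D', supported Vgen D' /\ lin_equiv G' D D').

Definition property2 (V : finType) (G G' : ribbon_graph V) (Vgen : {set V}) : Prop :=
  forall D1 D2 : V -> int, deg D1 = 0 -> deg D2 = 0 ->
    supported Vgen D1 -> supported Vgen D2 ->
    (lin_equiv G D1 D2 <-> lin_equiv G' D1 D2).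

Definition tree_bijection (V : finType) (G G' : ribbon_graph V)
    (phi : {set edge G} -> {set edge G'}) : Prop :=
  (forall T, spanning_tree G T -> spanning_tree G' (phi T)) /\
  (forall T1 T2, spanning_tree G T1 -> spanning_tree G T2 -> phi T1 = phi T2 -> T1 = T2) /\
  (forall T', spanning_tree G' T' -> exists2 T, spanning_tree G T & phi T = T').

(* Main.v *)
Require Import Defs.
From Stdlib Require Import Relations.Relation_Operators.
From HB Require Import structures.
From mathcomp Require Import all_boot all_order all_algebra.
From mathcomp Require Import zify.
Set Implicit Arguments. Unset Strict Implicit. Unset Printing Implicit Defensive.
Import Order.TTheory GRing.Theory Num.Theory.
Local Open Scope ring_scope.

(* Join a center to two leaves a and b by p and q parallel edges, the edges to a
   and those to b forming two blocks of the cyclic order at the center. The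
   spanning trees are the pairs (i, j) in Z/p x Z/q, and a degree-zero class is
   given by its chip counts at a and b modulo p and q. In these coordinates both
   torsors act by translations: (D(a), D(b)) is added to (i, j) for rotor
   routing and subtracted for Bernardi, except that the sign of a coordinate is
   reversed when the basepoint is the corresponding leaf.
   For q <= 2 the sign of the second coordinate is immaterial. Hence the graphs
   with (p, q) = (3, 2) and (6, 1), whose genera are 1 and 2, have the same
   torsors under Z/3 x Z/2 = Z/6, and the classes correspond through the
   representatives supported on {a, b}.
   The rotor routing formula comes from a potential of chips and rotors that
   every step preserves modulo p (resp. q). The Bernardi formula is checked by
   evaluating the tours of the two graphs. *)

(** * Two-leaf stars *)

Section Star.
Variable m : bool -> nat.

(* Leaf [Some x] is joined to the center [None] by [(m x).+1] parallel edges. *)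
Definition star_edge : finType := ('I_(m true).+1 + 'I_(m false).+1)%type.

(** Any natural number is accepted as an index and reduced by [inZp], so a rotation at a leaf is a
    successor and one number can index spokes of both blocks. *)
Definition spoke (x : bool) (k : nat) : star_edge :=
  if x then inl (inZp k) else inr (inZp k).

Definition side (e : star_edge) : bool := if e is inl _ then true else false.

Definition idx (e : star_edge) : nat :=
  match e with inl i => i | inr j => j end.

Definition star_rot (u : option bool) (e : star_edge) : star_edge :=
  if (u == None) && (idx e == m (side e)) then spoke (~~ side e) 0
  else spoke (side e) (idx e).+1.

Definition star : ribbon_graph (option bool) :=
  @RibbonGraph _ star_edge (fun e => (None, Some (side e))) star_rot.

Lemma side_spoke x k : side (spoke x k) = x.
Proof. by case: x. Qed.

Lemma idx_spoke x k : idx (spoke x k) = (k %% (m x).+1)%N.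
Proof. by case: x. Qed.

Lemma idx_le e : (idx e <= m (side e))%N.
Proof. by case: e => i /=; rewrite -ltnS. Qed.

Lemma star_edge_inj e f : side e = side f -> idx e = idx f -> e = f.
Proof. by case: e f => i [] j //= _ /val_inj->. Qed.

Lemma spoke_idx e x : x = side e -> spoke x (idx e) = e.
Proof.
move=> ->; apply: star_edge_inj; rewrite ?side_spoke // idx_spoke modn_small //.
by rewrite ltnS idx_le.
Qed.

Lemma spoke_modn x k : spoke x (k %% (m x).+1) = spoke x k.
Proof. by apply: star_edge_inj; rewrite ?side_spoke // !idx_spoke modn_mod. Qed.

Lemma spoke_last x : spoke x (m x).+1 = spoke x 0.
Proof. by rewrite -spoke_modn modnn. Qed.

Lemma incident_center e : incident star None e.
Proof. by []. Qed.

Lemma incident_leaf x e : incident star (Some x) e = (side e == x).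
Proof. by []. Qed.

Lemma other_center e : other star e None = Some (side e).
Proof. by []. Qed.

Lemma other_leaf e x : other star e (Some x) = None.
Proof. by []. Qed.

Lemma star_rot_leaf x e : star_rot (Some x) e = spoke (side e) (idx e).+1.
Proof. by []. Qed.

Lemma rot_star : Defs.rot star = star_rot.
Proof. by []. Qed.

Lemma star_rot_center e : star_rot None e =
  if idx e == m (side e) then spoke (~~ side e) 0 else spoke (side e) (idx e).+1.
Proof. by []. Qed.

Lemma star_rot_spoke u x k : (k < m x)%N -> star_rot u (spoke x k) = spoke x k.+1.
Proof.
move=> lt_k; rewrite /star_rot !side_spoke !idx_spoke modn_small ?ltnS 1?ltnW //.
by rewrite (ltn_eqF lt_k) andbF.
Qed.

Lemma fconnect_star_rot_add u x k l : (k <= l <= m x)%N ->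
  fconnect (star_rot u) (spoke x k) (spoke x l).
Proof.
case/andP=> /subnK<-; elim: (l - k)%N => // d IHd le_d.
apply: connect_trans (IHd (ltnW le_d)) _.
by rewrite addSn -(@star_rot_spoke u) //; apply: fconnect1.
Qed.

Lemma fconnect_star_rot_last u e :
  fconnect (star_rot u) e (spoke (side e) (m (side e))).
Proof.
by rewrite -{1}(@spoke_idx e (side e)) //; apply: fconnect_star_rot_add; rewrite idx_le leqnn.
Qed.

Lemma fconnect_star_rot_first u e :
  fconnect (star_rot u) (spoke (side e) 0) e.
Proof.
by rewrite -{2}(@spoke_idx e (side e)) //; apply: fconnect_star_rot_add; rewrite idx_le.
Qed.

Lemma star_rot_leaf_last x y : star_rot (Some y) (spoke x (m x)) = spoke x 0.
Proof. by rewrite star_rot_leaf side_spoke idx_spoke modn_small // spoke_last. Qed.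

Lemma star_rot_center_last x : star_rot None (spoke x (m x)) = spoke (~~ x) 0.
Proof. by rewrite star_rot_center side_spoke idx_spoke modn_small // eqxx. Qed.

Lemma star_rot_center_next e :
  fconnect (star_rot None) e (spoke (~~ side e) 0).
Proof.
apply: connect_trans (fconnect_star_rot_last _ _) _.
by rewrite -star_rot_center_last; apply: fconnect1.
Qed.

Lemma spokeS_inj e f : side e = side f ->
  spoke (side e) (idx e).+1 = spoke (side f) (idx f).+1 -> e = f.
Proof.
move=> se /(congr1 idx); rewrite !idx_spoke -se => eq_idx.
apply: star_edge_inj => //; move/eqP: eq_idx; rewrite -[_.+1]addn1 -[X in _ == X %[mod _]]addn1.
rewrite eqn_modDr => /eqP; rewrite !modn_small // ltnS ?idx_le // se idx_le //.
Qed.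

(** A value of nonzero index comes from its own block, a value of index 0 from the last spoke of the
    other block. *)
Lemma star_rot_center_inj : injective (star_rot None).
Proof.
have pos e : idx e != m (side e) -> idx (spoke (side e) (idx e).+1) != 0%N.
  by have := idx_le e; rewrite idx_spoke => le_e ne_e; rewrite modn_small //; lia.
move=> e f; rewrite !star_rot_center.
case: eqP => [ie|/eqP/pos pe]; case: eqP => [jf|/eqP/pos pf] eq_rot.
- have /negb_inj ss : ~~ side e = ~~ side f.
    by move/(congr1 side): eq_rot; rewrite !side_spoke.
  by apply: star_edge_inj; rewrite // ie jf ss.
- by rewrite -eq_rot idx_spoke mod0n in pf.
- by rewrite eq_rot idx_spoke mod0n in pe.
by apply: spokeS_inj => //; move/(congr1 side): eq_rot; rewrite !side_spoke.
Qed.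

Lemma star_adjP (A : {set edge star}) x y : reflect (exists2 e, e \in A &
    (x = None /\ y = Some (side e)) \/ (x = Some (side e) /\ y = None))
  (adj_in star A x y).
Proof.
apply: (iffP existsP) => [[e /and3P[eA inc /eqP->]] | [e eA xy]]; exists e.
- by [].
- case: x inc => [x|] inc; last by left.
  by right; move: inc; rewrite incident_leaf => /eqP->.
case: xy => [] [-> ->]; rewrite eA ?incident_center ?incident_leaf ?eqxx //=.
Qed.

Lemma star_connected_in (A : {set edge star}) : (forall x, exists2 e, e \in A & side e = x) ->
  connected_in star A.
Proof.
move=> hA.
have to_center u : connect (adj_in star A) u None.
  case: u => [x|]; last exact: connect0.
  have [e eA <-] := hA x; apply: connect1.
  by apply/star_adjP; exists e => //; right.
have of_center u : connect (adj_in star A) None u.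
  case: u => [x|]; last exact: connect0.
  have [e eA <-] := hA x; apply: connect1.
  by apply/star_adjP; exists e => //; left.
by move=> u v; apply: connect_trans (to_center u) (of_center v).
Qed.

Lemma star_connect_center (A : {set edge star}) x :
  connect (adj_in star A) None (Some x) -> exists2 e, e \in A & side e = x.
Proof.
case/connectP=> p; elim/last_ind: p => // p z _; rewrite rcons_path last_rcons.
move=> /andP[_ /star_adjP[e eA zx]] xz; exists e => //.
by case: zx => [] [_]; rewrite -xz => // -[].
Qed.

Lemma star_ribbon : is_ribbon_graph star.
Proof.
split=> //; split.
  by apply: star_connected_in => x; exists (spoke x 0); rewrite ?side_spoke.
case=> [x|]; (split; last split).
- by move=> e; rewrite !incident_leaf rot_star star_rot_leaf side_spoke.
- move=> e f; rewrite !incident_leaf => /eqP se /eqP sf.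
  by rewrite rot_star !star_rot_leaf => /spokeS_inj; apply; rewrite se sf.
- move=> e f; rewrite !incident_leaf => /eqP se /eqP sf.
  apply: connect_trans (fconnect_star_rot_last _ _) _.
  apply: connect_trans (fconnect1 _ _) _.
  by rewrite star_rot_leaf_last se -sf; apply: fconnect_star_rot_first.
- by [].
- by move=> e f _ _; apply: star_rot_center_inj.
move=> e f _ _; have := star_rot_center_next e.
case: (eqVneq (side f) (side e)) => [sf ce|ne].
  (* Within one block the rotation passes through the other block and returns to the first spoke. *)
  apply: connect_trans ce _; apply: connect_trans (star_rot_center_next _) _.
  by rewrite side_spoke negbK -sf; apply: fconnect_star_rot_first.
have <- : side f = ~~ side e by case: (side f) (side e) ne => [] [].
by move/connect_trans; apply; apply: fconnect_star_rot_first.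
Qed.

End Star.

(** * Spanning trees and divisor classes of a star *)

Section StarTrees.
Variable m : bool -> nat.
Implicit Types (k l : bool -> nat) (e f : star_edge m) (T : {set edge (star m)}).

Definition star_tree k : {set edge (star m)} :=
  [set e : star_edge m | e == spoke m (side e) (k (side e))].

Lemma in_star_tree k e : (e \in star_tree k) = (e == spoke m (side e) (k (side e))).
Proof. by rewrite inE. Qed.

Lemma spoke_eq x n n' : (spoke m x n == spoke m x n') = (n == n' %[mod (m x).+1]).
Proof.
apply/eqP/eqP=> [/(congr1 (@idx m))|eq_n]; first by rewrite !idx_spoke.
by rewrite -spoke_modn eq_n spoke_modn.
Qed.

Lemma spoke_in_star_tree k x n : (spoke m x n \in star_tree k) = (n == k x %[mod (m x).+1]).
Proof. by rewrite in_star_tree side_spoke spoke_eq. Qed.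

Lemma eq_star_treeP k l : star_tree k = star_tree l <-> forall x, k x = l x %[mod (m x).+1].
Proof.
split=> [eq_kl x | eq_kl].
  by apply/eqP; rewrite -spoke_in_star_tree -eq_kl spoke_in_star_tree.
apply/setP=> e; rewrite !in_star_tree; congr (_ == _).
by apply/eqP; rewrite spoke_eq; apply/eqP.
Qed.

(** Connectedness puts a spoke at each leaf in [T]; a second spoke there would be parallel to it,
    hence removable. Conversely, removing the only spoke at a leaf isolates that leaf. *)
Lemma star_spanning_treeP T : spanning_tree (star m) T <-> exists k, T = star_tree k.
Proof.
split=> [[conT minT] | [k ->]].
  have [k Hk] : exists k, forall x, spoke m x (k x) \in T.
    have ex x : exists n, spoke m x n \in T.
      have [e eT <-] := star_connect_center (conT None (Some x)).
      by exists (idx e); rewrite spoke_idx.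
    exists (fun x => xchoose (ex x)) => x; exact: (xchooseP (ex x)).
  exists k; apply/setP=> e; rewrite in_star_tree.
  apply/idP/eqP=> [eT | ->]; last exact: Hk.
  apply/eqP/negPn/negP => ne; have := minT e eT; apply.
  apply: connect1; apply/star_adjP; exists (spoke m (side e) (k (side e))).
    by rewrite !inE eq_sym ne Hk.
  by left; rewrite side_spoke.
split.
  by apply: star_connected_in => x; exists (spoke m x (k x)); rewrite ?side_spoke ?spoke_in_star_tree.
move=> e; rewrite in_star_tree => /eqP ee /star_connect_center[f].
rewrite !inE => /andP[ne /eqP ef] sf; case/eqP: ne.
by rewrite ef sf -ee.
Qed.

Lemma deg_star (D : option bool -> int) x :
  deg D = D None + D (Some x) + D (Some (~~ x)).
Proof.
rewrite /deg (bigD1 None) //= (bigD1 (Some x)) //= (bigD1 (Some (~~ x))) /=; last by case: x.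
rewrite big1 ?addr0 ?addrA //; case=> [y|] //=.
by case: x y => [] [].
Qed.

Lemma sum_incident_leaf (c : int) x :
  \sum_(e : star_edge m | incident (star m) (Some x) e) c = c *+ (m x).+1.
Proof.
under eq_bigl do rewrite incident_leaf.
rewrite big_sumType /=; case: x => /=.
  by rewrite [X in _ + X]big_pred0_eq addr0 sumr_const card_ord.
by rewrite [X in X + _]big_pred0_eq add0r sumr_const card_ord.
Qed.

Lemma sum_incident_center (F : star_edge m -> int) (c : bool -> int) :
  (forall e, F e = c (side e)) ->
  \sum_(e : star_edge m | incident (star m) None e) F e
     = c true *+ (m true).+1 + c false *+ (m false).+1.
Proof.
move=> Fc; under eq_bigl do rewrite incident_center.
rewrite big_sumType /=; under eq_bigr do rewrite Fc /=.
under [X in _ + X]eq_bigr do rewrite Fc /=.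
by rewrite !sumr_const !card_ord.
Qed.

(** The Laplacian of [g] at leaf [x] is [(m x).+1] times [g (Some x) - g None]. With [g None = 0]
    these multiples are arbitrary, and the degree fixes the value at the center. *)
Lemma star_lin_equivP (D1 D2 : option bool -> int) :
  lin_equiv (star m) D1 D2 <->
  deg D1 = deg D2 /\ forall x, ((m x).+1%:Z %| D1 (Some x) - D2 (Some x))%Z.
Proof.
have leaf (g : option bool -> int) x :
    \sum_(e | incident (star m) (Some x) e) (g (Some x) - g (other (star m) e (Some x)))
    = (g (Some x) - g None) *+ (m x).+1.
  exact: (sum_incident_leaf (g (Some x) - g None)).
have center (g : option bool -> int) :
    \sum_(e | incident (star m) None e) (g None - g (other (star m) e None))
    = (g None - g (Some true)) *+ (m true).+1 + (g None - g (Some false)) *+ (m false).+1.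
  exact: (@sum_incident_center _ (fun x : bool => g None - g (Some x))).
split=> [[g Dg] | [eq_deg dvd]].
  split=> [|x]; last by rewrite Dg leaf -mulr_natr dvdz_mull //; rewrite natz dvdzz.
  move: (Dg None) (Dg (Some true)) (Dg (Some false)).
  rewrite !leaf center !(deg_star _ true) /= -[g (Some true) - _]opprB -[g (Some false) - _]opprB !mulNrn.
  by move: (_ *+ _) (_ *+ _) => a b; clear; lia.
have [/dvdzP[a Ea] /dvdzP[b Eb]] := (dvd true, dvd false).
have [g [gN ga gb]] : exists g : option bool -> int,
    [/\ g None = 0, g (Some true) = a & g (Some false) = b].
  by exists (fun u => if u is Some x then if x then a else b else 0).
have {eq_deg} EN : D1 None - D2 None = - (D1 (Some true) - D2 (Some true))
    - (D1 (Some false) - D2 (Some false)).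
  by move: eq_deg; rewrite !(deg_star _ true) /=; lia.
exists g => -[x|].
  by rewrite leaf gN subr0 -mulr_natr natz; case: x; rewrite ?ga ?gb.
rewrite center gN ga gb !sub0r !mulNrn -(mulr_natr a) -(mulr_natr b) !natz.
by rewrite EN Ea Eb.
Qed.

End StarTrees.

(** * Rotor routing *)

Section RotorRun.
Variables (V : finType) (G : ribbon_graph V) (v : V).
Implicit Types (s : (V -> int) * (V -> edge G)).

Definition fire s (u : V) : (V -> int) * (V -> edge G) :=
  let e := Defs.rot G u (s.2 u) in
  (fun w => s.1 w - (nat_of_bool (w == u))%:Z + (nat_of_bool (w == other G e u))%:Z,
   fun w => if w == u then e else s.2 w).

Lemma rr_step_fire s u : u != v -> 0 < s.1 u -> rr_step G v s (fire s u).
Proof. by move=> uv su; exists u; do !split=> //=; rewrite eqxx. Qed.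

(** A termination principle: a measure that is nonnegative under the invariant [P] and drops at
    every step bounds the run. At its end no chip count off [v] is positive; that none is negative
    has to come from [P]. *)
Lemma rr_run (P : (V -> int) * (V -> edge G) -> Prop) mu :
  (forall s, P s -> 0 <= mu s :> int) ->
  (forall s u, P s -> u != v -> 0 < s.1 u -> P (fire s u) /\ mu (fire s u) < mu s) ->
  forall s, P s -> exists sf, [/\ clos_refl_trans _ (rr_step G v) s sf, P sf
    & forall u, u != v -> sf.1 u <= 0].
Proof.
move=> mu_ge0 stepP s; have [n] := ubnP `|mu s|%N; elim: n s => // n IHn s le_n Ps.
case: (pickP (fun u => (u != v) && (0 < s.1 u))) => [u /andP[uv su] | no].
  have [Pf lt_mu] := stepP s u Ps uv su.
  have [|sf [run Psf sf0]] := IHn (fire s u) _ Pf.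
    by have := mu_ge0 _ Pf; have := mu_ge0 _ Ps; lia.
  exists sf; split=> //; apply: rt_trans run; apply: rt_step.
  exact: rr_step_fire.
exists s; split=> // [|u uv]; first exact: rt_refl.
by have := no u; rewrite uv /= ltNge => /negbFE.
Qed.

End RotorRun.

Lemma dvdz_modn_sub (d n : nat) : (d%:Z %| (n %% d)%N%:Z - n%:Z)%Z.
Proof.
by rewrite -eqz_mod_dvd -modz_nat modz_mod.
Qed.

(** * The rotor routing action on a star *)

Section StarRotor.
Variable m : bool -> nat.
Local Notation G := (star m).
Implicit Types (v : option bool) (k l : bool -> nat) (e : star_edge m).
Implicit Types (c D : option bool -> int) (r : option bool -> star_edge m).

(** The condition on rotors that survives every step; [tree_rotors] is what holds at the two ends of
    a run. *)
Definition spoke_rotors v r := forall x, v != Some x -> side (r (Some x)) = x.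

Definition tree_rotors v k r := forall x,
  if v == Some x then r None = spoke m x (k x) else r (Some x) = spoke m x (k x).

Lemma tree_spoke_rotors v k r : tree_rotors v k r -> spoke_rotors v r.
Proof. by move=> tr x /negPf vx; have := tr x; rewrite vx => ->; rewrite side_spoke. Qed.

Lemma tree_rotors_oriented v k r : tree_rotors v k r -> oriented_to G (star_tree m k) v r.
Proof.
move=> tr u uv; set step := (fun x y => _).
have ru : exists x, r u = spoke m x (k x).
  case: u uv => [x|] uv; first by exists x; have := tr x; rewrite eq_sym (negPf uv).
  by case: v uv tr {step} => // y _ /(_ y); rewrite eqxx => ->; exists y.
have leaf x : v != Some x -> connect step (Some x) None.
  by move=> vx; apply: connect1; rewrite /step eq_sym vx.
have center : connect step None v.
  case Ev: v => [y|]; last exact: connect0.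
  have := tr y; rewrite Ev eqxx => rN.
  by apply: connect1; rewrite /step Ev rN other_center side_spoke eqxx.
split; last split.
- by case: ru => x ->; rewrite spoke_in_star_tree.
- case: u uv {ru} => // x uv; rewrite incident_leaf.
  by have := tr x; rewrite eq_sym (negPf uv) => ->; rewrite side_spoke.
by case: u uv {ru} => [x|] // uv; apply: connect_trans center; apply: leaf; rewrite eq_sym.
Qed.

Lemma oriented_tree_rotors v k r : oriented_to G (star_tree m k) v r -> tree_rotors v k r.
Proof.
move=> ori x; case: eqP => [vx | /eqP vx].
  have [|rT [_ con]] := ori None; first by rewrite vx.
  move: rT; rewrite in_star_tree => /eqP rN; rewrite rN.
  suff -> : side (r None) = x by [].
  (* A path into the sink leaf must end with the center following its own rotor. *)
  apply/eqP/negPn/negP => ne; case/connectP: con => p.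
  elim/last_ind: p => [|p z _]; rewrite ?vx // rcons_path last_rcons.
  case/andP=> _ /andP[_ /eqP ->]; case: (last None p) => [y|] //.
  by rewrite other_center => -[/eqP]; rewrite eq_sym (negPf ne).
have [|rT [inc _]] := ori (Some x); first by rewrite eq_sym.
by move: inc; rewrite incident_leaf => /eqP sx; move: rT; rewrite in_star_tree sx => /eqP.
Qed.

(** The rotor of a leaf other than the sink lies on its own side, so the tree's spoke at a sink leaf
    can only be the rotor of the center. *)
Lemma tree_rotors_image v k r : spoke_rotors v r ->
  star_tree m k = [set r u | u in [set~ v]] -> tree_rotors v k r.
Proof.
move=> ok eqT x; case: eqP => [vx | /eqP vx].
  have : spoke m x (k x) \in star_tree m k by rewrite spoke_in_star_tree.
  rewrite eqT => /imsetP[[y|] //]; rewrite !inE vx => yx.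
  move/(congr1 (@side m)); rewrite side_spoke ok; last by rewrite vx eq_sym.
  by move=> xy; rewrite xy eqxx in yx.
have : r (Some x) \in star_tree m k.
  by rewrite eqT; apply/imsetP; exists (Some x); rewrite // !inE eq_sym.
by rewrite in_star_tree ok // => /eqP.
Qed.

Lemma image_tree_rotors v k r : tree_rotors v k r ->
  star_tree m k = [set r u | u in [set~ v]].
Proof.
move=> tr; have ok := tree_spoke_rotors tr.
apply/setP=> e; rewrite in_star_tree; apply/eqP/imsetP => [-> | [u]].
  have := tr (side e); case: eqP => [vx <- | /eqP vx <-]; last first.
    by exists (Some (side e)); rewrite // !inE eq_sym.
  by exists None; rewrite // !inE vx.
rewrite !inE => uv; case: u uv => [x|] uv.
  by move=> ->; rewrite ok 1?eq_sym //; have := tr x; rewrite eq_sym (negPf uv).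
case: v uv tr {ok} => // y _ /(_ y); rewrite eqxx => -> ->.
by rewrite side_spoke.
Qed.

(* Modulo [(m x).+1], this drops by one exactly when the center routes a chip
   to leaf [x]. *)
Definition center_weight x e : int := if side e == x then - (idx e)%:Z else 1.

(** A chip leaving leaf [x] is balanced by the index of the rotor there, a chip arriving at [x] by
    [center_weight]. The rotor of the sink is arbitrary and never turns, so its term is replaced by
    0. *)
Definition rotor_potential v x (s : (option bool -> int) * (option bool -> star_edge m)) : int :=
  s.1 (Some x) + (if v == Some x then 0 else (idx (s.2 (Some x)))%:Z)
  + (if v == None then 0 else center_weight x (s.2 None)).

(** The expression is 0 unless the center leaves the block of [x]; then the weight goes from [- m x]
    to 1, a change of [(m x).+1]. *)
Lemma center_weight_rot x e : ((m x).+1%:Z %|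
  (nat_of_bool (x == side (star_rot None e)))%:Z + center_weight x (star_rot None e)
   - center_weight x e)%Z.
Proof.
set z := _ - _; suff: z = 0 \/ z = (m x).+1%:Z by case=> ->; rewrite ?dvdz0 ?dvdzz.
rewrite /z star_rot_center /center_weight; have le_e := idx_le e.
case: (idx e =P m (side e)) => ie; rewrite side_spoke idx_spoke ?mod0n ?modn_small; last by lia.
  by rewrite ie; case: (side e) x {z} => [] []; rewrite /=; lia.
by case: (side e) x {z} => [] []; rewrite /=; lia.
Qed.

Lemma rr_step_invariant v s s' : rr_step G v s s' -> spoke_rotors v s.2 ->
  [/\ spoke_rotors v s'.2, deg s'.1 = deg s.1
    & forall x, ((m x).+1%:Z %| rotor_potential v x s' - rotor_potential v x s)%Z].
Proof.
case=> u [uv [_ [r' c']]] ok; split.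
- by move=> x vx; rewrite r'; case: eqP => [<-|_]; rewrite ?rot_star ?star_rot_leaf ?side_spoke ok.
- by rewrite !(deg_star _ true) !c'; case: u uv r' c' => [[]|] uv r' c';
     rewrite ?other_leaf ?other_center /=; try case: (side _) => /=; lia.
move=> x; rewrite /rotor_potential !c' !r'; case: u uv {c'} r' => [y|] uv r'.
  rewrite other_leaf /= addr0; case: (eqVneq x y) => [eq_xy|ne].
    rewrite -eq_xy {y eq_xy r'} in uv *.
    have vx : v != Some x by rewrite eq_sym.
    rewrite eqxx (negPf vx) star_rot_leaf ok // idx_spoke.
    have := dvdz_modn_sub (m x).+1 (idx (s.2 (Some x))).+1.
    congr (_ %| _)%Z; move: (_ %% _)%N (if v == None then _ else _) => a b.
    by rewrite [nat_of_bool _]/=; move: (s.1 _) (idx _) => c d; lia.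
  rewrite (inj_eq Some_inj) (negPf ne).
  set z := _ - _; suff -> : z = 0 by rewrite dvdz0.
  by rewrite /z; lia.
rewrite eqxx /= other_center [v == None]eq_sym (negPf uv) (inj_eq Some_inj).
have := center_weight_rot x (s.2 None).
congr (_ %| _)%Z; move: (nat_of_bool _) (center_weight _ _) (center_weight _ _).
by move: (if v == _ then _ else _) => a b c d; lia.
Qed.

Lemma rr_steps_invariant v s s' : clos_refl_trans _ (rr_step G v) s s' ->
  spoke_rotors v s.2 ->
  [/\ spoke_rotors v s'.2, deg s'.1 = deg s.1
    & forall x, ((m x).+1%:Z %| rotor_potential v x s' - rotor_potential v x s)%Z].
Proof.
elim=> {s s'} [s s' | s ok | s1 s2 s3 _ IH1 _ IH2 ok]; first exact: rr_step_invariant.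
  by split=> // x; rewrite subrr dvdz0.
have [ok2 deg2 dvd2] := IH1 ok; have [ok3 deg3 dvd3] := IH2 ok2.
split=> // [|x]; first by rewrite deg3.
by rewrite -(subrKA (rotor_potential v x s2)) rpredD.
Qed.

(** At a sink leaf the tree's spoke is the rotor of the center, and [center_weight] counts its index
    negatively. *)
Definition leaf_sign v x : int := if v == Some x then -1 else 1.

(** The last summand is the weight of the center's rotor when it points to the other leaf, the sink.
    It does not depend on [k] and cancels between the two ends of a run. *)
Lemma rotor_potential_tree v k c r x : tree_rotors v k r ->
  ((m x).+1%:Z %| rotor_potential v x (c, r) - (c (Some x) + leaf_sign v x * (k x)%:Z
    + (nat_of_bool ((v != Some x) && (v != None)))%:Z))%Z.
Proof.
move=> tr; rewrite /rotor_potential /leaf_sign /center_weight /=.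
have := dvdz_modn_sub (m x).+1 (k x); have := tr x.
case: (eqVneq v (Some x)) => [->|vx] -> /=.
  by rewrite side_spoke eqxx idx_spoke => /(dvdz_mull (-1)); congr (_ %| _)%Z; move: (_ %% _)%N => a; lia.
rewrite idx_spoke; case: v vx tr => [y|] vx tr /=; last by congr (_ %| _)%Z; move: (_ %% _)%N => a; lia.
have := tr y; rewrite eqxx => ->; rewrite side_spoke.
have -> : (y == x) = false by apply: contraNF vx => /eqP->.
by congr (_ %| _)%Z; move: (_ %% _)%N => a; lia.
Qed.

Lemma rotor_torsor_congr v D k l : deg D = 0 ->
  rotor_torsor G v D (star_tree m k) (star_tree m l) ->
  forall x, ((m x).+1%:Z %| (l x)%:Z - (k x)%:Z - leaf_sign v x * D (Some x))%Z.
Proof.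
move=> degD [c0 [r0 [cf [rf [eqD [c0_ge0 [ori [run [cf0 im]]]]]]]]] x.
have tr0 := oriented_tree_rotors ori.
have [okf degf /(_ x) dvdf] := rr_steps_invariant run (tree_spoke_rotors tr0).
have trf := tree_rotors_image okf im.
have [degc0 /(_ x) dvdD] := (star_lin_equivP m c0 D).1 eqD.
(* If [Some x] is the sink, its count vanishes because the total degree is still 0. *)
have cfx : cf (Some x) = 0.
  case: (eqVneq v (Some x)) => [vx|]; last by rewrite eq_sym => /cf0.
  move: degf; rewrite /= degc0 degD (deg_star cf x) (cf0 None) ?vx //.
  rewrite (cf0 (Some (~~ x))) ?vx; first by rewrite add0r addr0.
  by rewrite (inj_eq Some_inj); case: (x).
have := rpredD (rpredB dvdf (rotor_potential_tree cf x trf))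
  (rpredD (rotor_potential_tree c0 x tr0) dvdD).
move/(dvdz_mull (leaf_sign v x)); congr (_ %| _)%Z; rewrite cfx.
rewrite /leaf_sign; move: (rotor_potential _ _ _) (rotor_potential _ _ _).
move: (nat_of_bool _) (c0 _) (D _) (k x) (l x) => a b c d e f g.
by case: ifP => _; lia.
Qed.

(* The number of steps that the center takes towards the other leaf before it
   next sends a chip to leaf [y]. *)
Definition center_delay y e : nat :=
  if side e == y then if idx e == m y then (m (~~ y)).+1 else 0
  else (m (~~ y) - idx e)%N.

(** The bound in the first case limits how far the delay can grow when a chip reaches the sink; the
    chip's factor in [routing_measure] exceeds twice that bound. *)
Lemma center_delay_rot y e :
  if side (star_rot None e) == y then (center_delay y (star_rot None e) <= (m (~~ y)).+1)%N
  else center_delay y e == (center_delay y (star_rot None e)).+1.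
Proof.
have le_e := idx_le e; rewrite /center_delay star_rot_center.
case: (idx e =P m (side e)) => ie; rewrite side_spoke idx_spoke ?mod0n ?modn_small; try lia.
  by move: ie le_e; case: (side e) y => [] [] /= -> _; rewrite ?eqxx //; try case: ifP => _; lia.
by move: ie le_e; case: (side e) y => [] [] /=; try case: ifP => _; lia.
Qed.

(* The number of chips off the sink [Some y] dominates. While it is constant, a
   step of the center puts one chip on the other leaf and lowers the delay by
   one, whence the factor 2. *)
Definition routing_measure v (s : (option bool -> int) * (option bool -> star_edge m)) : int :=
  if v is Some y then
    ((m (~~ y)).+1.*2.+1)%:Z * (s.1 None + s.1 (Some (~~ y)))
    + (center_delay y (s.2 None)).*2%:Z + s.1 (Some (~~ y))
  else s.1 (Some true) + s.1 (Some false).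

(** For a leaf sink [y] the final rotors form a tree only if the center points to [y]. The invariant
    [P] says that it does or that a chip remains off the sink: turning to the other leaf puts a chip
    there. *)
Lemma rotor_routing_stops v c r : spoke_rotors v r -> (forall u, u != v -> 0 <= c u) ->
  (forall y, v = Some y -> side (r None) = y) ->
  exists cf rf l, [/\ clos_refl_trans _ (rr_step G v) (c, r) (cf, rf),
    forall u, u != v -> cf u = 0 & tree_rotors v l rf].
Proof.
move=> ok c_ge0 rc.
pose P (s : (option bool -> int) * (option bool -> edge G)) :=
  [/\ spoke_rotors v s.2, forall u, u != v -> 0 <= s.1 u
    & forall y, v = Some y -> side (s.2 None) = y \/ 0 < s.1 None + s.1 (Some (~~ y))].
have sN y : Some (~~ y) != Some y by rewrite (inj_eq Some_inj); case: y.
have mu_ge0 s : P s -> 0 <= routing_measure v s.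
  case=> _ s_ge0 _; rewrite /routing_measure; case Ev: v => [y|].
    have [c0 x0] : 0 <= s.1 None /\ 0 <= s.1 (Some (~~ y)) by rewrite !s_ge0 ?Ev.
    by rewrite addr_ge0 // addr_ge0 // mulr_ge0 // addr_ge0.
  by rewrite addr_ge0 ?s_ge0 ?Ev.
have stepP s u : P s -> u != v -> 0 < s.1 u ->
    P (fire s u) /\ routing_measure v (fire s u) < routing_measure v s.
  case=> oks s_ge0 rs uv su.
  have [okf _ _] := rr_step_invariant (rr_step_fire uv su) oks.
  have f_ge0 w : w != v -> 0 <= (fire s u).1 w.
    move=> /s_ge0 sw /=; move: (nat_of_bool (w == other _ _ _)) => a.
    case: eqP => [->|_] /=; first by move: su; move: (s.1 u) => z; lia.
    by move: sw; move: (s.1 w) => z; lia.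
  case: u uv su okf f_ge0 => [x|] uv su okf f_ge0.
    have fN : (fire s (Some x)).1 None = s.1 None + 1 by rewrite /= subr0.
    have fS z : (fire s (Some x)).1 (Some z) = s.1 (Some z) - (z == x)%:Z.
      exact: addr0.
    have vx y : v = Some y -> x = ~~ y.
      by move=> vy; move: uv; rewrite vy (inj_eq Some_inj); case: (x) (y) => [] [].
    have -> : routing_measure v (fire s (Some x)) = routing_measure v s - 1.
      rewrite /routing_measure; case Ev: v => [y|].
        rewrite fN fS -(vx y) // eqxx [nat_of_bool true]/=; move: (s.1 None) (s.1 (Some x)) => a b.
        have -> : a + 1 + (b - 1%:Z) = a + b by lia.
        by rewrite (_ : (fire s (Some x)).2 None = s.2 None) // addrA.
      by rewrite !fS; move: (s.1 _) (s.1 _) => a b; case: (x); lia.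
    split; last by move: (routing_measure _ _) => z; lia.
    split=> // y vy; right; move: su (s_ge0 None); rewrite vy fN fS -(vx y) // eqxx [nat_of_bool true]/=.
    by move: (s.1 None) (s.1 (Some x)) => a b su /(_ isT); lia.
  case Ev: v uv => [y|] // _.
  have fN : (fire s None).1 None = s.1 None - 1 by exact: addr0.
  have fS z : (fire s None).1 (Some z) = s.1 (Some z) + (z == side (star_rot None (s.2 None)))%:Z.
    by rewrite /= subr0.
  have x_ge0 : 0 <= s.1 (Some (~~ y)) by rewrite s_ge0 ?Ev.
  have := center_delay_rot y (s.2 None).
  rewrite /routing_measure fN fS (_ : (fire s None).2 None = star_rot None (s.2 None)) //.
  case: eqP => [sy|/eqP ne].
    rewrite sy (_ : (~~ y == y) = false) ?[nat_of_bool false]/=; last by case: (y).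
    move=> le_d; split; first by split=> // z; rewrite Ev => -[<-]; left.
    move: le_d su x_ge0; move: (center_delay _ _) (center_delay _ _) (m _) (s.1 None) (s.1 (Some (~~ y))).
    by move=> a b d e f; lia.
  have yx : (~~ y == side (star_rot None (s.2 None))) = true by case: (side _) (y) ne => [] [].
  move=> /eqP ->; split.
    split=> // z; rewrite Ev => -[<-]; right; rewrite fN fS yx [nat_of_bool true]/=.
    by move: su x_ge0; move: (s.1 None) (s.1 (Some (~~ y))) => a b; lia.
  rewrite yx [nat_of_bool true]/=; move: su x_ge0.
  move: (center_delay _ _) (m _) (s.1 None) (s.1 (Some (~~ y))).
  by move=> a b d e; lia.
have P0 : P (c, r) by split=> // y /rc; left.
have [[cf rf] [run [okf cf_ge0 rcf] cf_le0]] := rr_run mu_ge0 stepP P0.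
have cf0 u : u != v -> cf u = 0.
  by move=> uv; apply/eqP; rewrite eq_le cf_le0 // cf_ge0.
exists cf, rf, (fun x => if v == Some x then idx (rf None) else idx (rf (Some x))).
split=> // x; case: eqP => [vx|/eqP vx]; last by rewrite spoke_idx // okf.
have := rcf x vx; rewrite /= !cf0 ?vx // => -[sx|//].
by rewrite spoke_idx.
Qed.

(** Moving multiples of [(m x).+1] chips between center and leaf keeps the class. A leaf other than
    the sink receives enough to cover its debt; a sink leaf [y] sends enough for the debt of the
    center and for the other leaf's share. *)
Lemma nonneg_off v D : exists c, lin_equiv G c D /\ forall u, u != v -> 0 <= c u.
Proof.
pose n (x : bool) : int := (m x).+1%:Z; pose a (x : bool) : int := `|D (Some x)|.
have n1 x : 1 <= n x by [].
have a_ge0 x : 0 <= a x by exact: normr_ge0.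
have aD x : - D (Some x) <= a x by have := ler_norm (- D (Some x)); rewrite normrN.
have an x : a x <= a x * n x by rewrite ler_peMr.
pose b (x : bool) : int := `|D None| + a (~~ x) * n (~~ x).
have b_ge0 x : 0 <= b x by rewrite addr_ge0 // (le_trans _ (an _)).
have bn x : b x <= b x * n x by rewrite ler_peMr.
pose s (x : bool) : int := if v == Some x then - b x else a x.
pose c (u : option bool) : int := if u is Some x then D (Some x) + s x * n x
  else D None - s true * n true - s false * n false.
exists c; split.
  apply/star_lin_equivP; split; first by rewrite !(deg_star _ true) /c /=; lia.
  by move=> x; rewrite /c addrAC subrr add0r dvdz_mull ?dvdzz.
case=> [x|] uv.
  by rewrite /c /s eq_sym (negPf uv); have := aD x; have := an x; lia.
case Ev: v uv => [y|] // _.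
have -> : c None = D None + b y * n y - a (~~ y) * n (~~ y).
  by rewrite /c /s Ev; case: (y) => /=; lia.
have := bn y; have := ler_norm (- D None); rewrite normrN {1}/b.
by move: (b y * _) (a _ * _) `|_| => d e f; lia.
Qed.

(** For the converse, some run ends in some tree [l'], and [rotor_torsor_congr] forces its indices
    to agree with those of [l]. *)
Lemma rotor_torsorP v D k l : deg D = 0 ->
  (rotor_torsor G v D (star_tree m k) (star_tree m l) <->
   forall x, ((m x).+1%:Z %| (l x)%:Z - (k x)%:Z - leaf_sign v x * D (Some x))%Z).
Proof.
move=> degD; split=> [|cong]; first exact: rotor_torsor_congr.
have [c [eqc c_ge0]] := nonneg_off v D.
pose r (u : option bool) := if u is Some x then spoke m x (k x)
  else if v is Some y then spoke m y (k y) else spoke m true 0.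
have tr : tree_rotors v k r by move=> x; case: eqP => [vx|_] //; rewrite /r vx.
have [|cf [rf [l' [run cf0 trf]]]] := rotor_routing_stops (tree_spoke_rotors tr) c_ge0.
  by move=> y vy; rewrite /r vy side_spoke.
have routed T : T = [set rf u | u in [set~ v]] -> rotor_torsor G v D (star_tree m k) T.
  move=> T_rf; exists c, r, cf, rf.
  by split=> //; split=> //; split; first exact: tree_rotors_oriented tr.
have T' := rotor_torsor_congr degD (routed _ (image_tree_rotors trf)).
apply: routed; rewrite -(image_tree_rotors trf); apply/eq_star_treeP => x; apply/eqP.
rewrite -eqz_nat -!modz_nat eqz_mod_dvd.
have := rpredB (cong x) (T' x).
by congr (_ %| _)%Z; move: (_ * _) => a; lia.
Qed.

End StarRotor.

(** * Bernardi tours *)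

(* [bwalk] with the tree given by a predicate: membership in a [{set _}] does
   not reduce, whereas this version can be evaluated. *)
Fixpoint tour_with (V : finType) (G : ribbon_graph V) (P : pred (edge G)) (start : edge G * V)
    (n : nat) (cur : edge G * V) (vis : seq (edge G * V)) (D : V -> int) : V -> int :=
  if n is n'.+1 then
    let e := cur.1 in let u := cur.2 in
    let nxtD :=
      if P e then ((Defs.rot G (other G e u) e, other G e u), D)
      else ((Defs.rot G u e, u),
            if (e, other G e u) \in vis then D
            else fun w => D w + (nat_of_bool (w == u))%:Z) in
    if nxtD.1 == start then nxtD.2
    else tour_with P start n' nxtD.1 (nxtD.1 :: vis) nxtD.2
  else D.

Lemma bwalk_tour_with (V : finType) (G : ribbon_graph V) (T : {set edge G}) (P : pred (edge G))
    start n cur vis D :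
  (forall e, (e \in T) = P e) -> bwalk G T start n cur vis D = tour_with P start n cur vis D.
Proof.
by move=> TP; elim: n cur vis D => //= n IHn cur vis D; rewrite TP; case: ifP => // _; rewrite IHn.
Qed.

Section StarBernardi.
Variable m : bool -> nat.
Local Notation G := (star m).

Definition star_edges : seq (star_edge m) :=
  [seq spoke m true k | k <- iota 0 (m true).+1] ++ [seq spoke m false k | k <- iota 0 (m false).+1].

Lemma mem_star_edges e : e \in star_edges.
Proof.
rewrite mem_cat; apply/orP; have le_e := idx_le e.
by case E: (side e) (le_e); [left | right]; apply/mapP; exists (idx e);
   rewrite ?spoke_idx // mem_iota /= add0n ltnS -E.
Qed.

Lemma card_star_edge : #|star_edge m| = ((m true).+1 + (m false).+1)%N.
Proof. by rewrite card_sum !card_ord. Qed.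

(** The number of steps is spelled out instead of using [#|edge G|], so that the tour can be
    evaluated. *)
Definition tour_div (k : bool -> nat) (v : option bool) (e0 : star_edge m) : option bool -> int :=
  @tour_with _ G (fun e => e == spoke m (side e) (k (side e))) (e0, v)
    (2 * ((m true).+1 + (m false).+1)).+1 (e0, v) [:: (e0, v)] (fun=> 0).

Lemma bernardi_divE k v e0 : bernardi_div G (star_tree m k) v e0 = tour_div k v e0.
Proof. by rewrite /bernardi_div card_star_edge; apply: bwalk_tour_with => e; rewrite in_star_tree. Qed.

(** Each tour is compared with that of the tree of index 0 from the same start. Degrees and ranges
    are written without big operators or enumerations, for evaluation. *)
Definition bernardi_check : bool :=
  all (fun i => all (fun j => all (fun v => all (fun e0 =>
    incident G v e0 ==>
    let k x := if x then i else j in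
    let B := tour_div k v e0 in let B0 := tour_div (fun=> 0%N) v e0 in
    (B None + B (Some true) + B (Some false) ==
       B0 None + B0 (Some true) + B0 (Some false)) &&
    all (fun x => ((m x).+1%:Z %| B (Some x) - B0 (Some x) + leaf_sign v x * (k x)%:Z)%Z)
      [:: true; false])
  star_edges) [:: None; Some true; Some false]) (iota 0 (m false).+1)) (iota 0 (m true).+1).

(** Reducing the indices modulo the multiplicities keeps the tree and brings it into the range of
    [bernardi_check]. *)
Lemma bernardi_div_congr k v e0 : bernardi_check -> incident G v e0 ->
  deg (bernardi_div G (star_tree m k) v e0) = deg (bernardi_div G (star_tree m (fun=> 0%N)) v e0) /\
  forall x, ((m x).+1%:Z %| bernardi_div G (star_tree m k) v e0 (Some x)
    - bernardi_div G (star_tree m (fun=> 0%N)) v e0 (Some x) + leaf_sign v x * (k x)%:Z)%Z.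
Proof.
pose i := (k true %% (m true).+1)%N; pose j := (k false %% (m false).+1)%N.
move=> ok inc; have -> : star_tree m k = star_tree m (fun x => if x then i else j).
  by apply/eq_star_treeP; case; rewrite modn_mod.
have hi : i \in iota 0 (m true).+1 by rewrite mem_iota add0n ltn_pmod.
have hj : j \in iota 0 (m false).+1 by rewrite mem_iota add0n ltn_pmod.
have hv : v \in [:: None; Some true; Some false] by case: (v) => [[]|].
have := allP (allP (allP (allP ok i hi) j hj) v hv) e0 (mem_star_edges e0).
move/implyP/(_ inc)/andP=> [/eqP eq_deg /allP dvd].
rewrite !bernardi_divE !(deg_star _ true); split=> // x.
have /dvd : x \in [:: true; false] by case: (x).
have /(dvdz_mull (leaf_sign v x)) := dvdz_modn_sub (m x).+1 (k x).
move=> d1 d2; have := rpredB d2 d1.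
congr (_ %| _)%Z; rewrite -addrA; congr (_ + _).
have -> : (if x then i else j) = (k x %% (m x).+1)%N by case: (x).
by rewrite mulrBr opprB addrCA subrr addr0.
Qed.

(** Subtracting the congruences for [k] and [l] eliminates the reference tree; the sign, its own
    inverse, then moves from the indices to [D]. *)
Lemma bernardi_relP v e0 D k l : bernardi_check -> incident G v e0 -> deg D = 0 ->
  (bernardi_rel G v e0 D (star_tree m k) (star_tree m l) <->
   forall x, ((m x).+1%:Z %| (l x)%:Z - (k x)%:Z + leaf_sign v x * D (Some x))%Z).
Proof.
move=> ok inc degD; have [degk dk] := bernardi_div_congr k ok inc.
have [degl dl] := bernardi_div_congr l ok inc.
have deg_eq : deg (bernardi_div G (star_tree m l) v e0)
    = deg (fun w => bernardi_div G (star_tree m k) v e0 w + D w).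
  by rewrite /deg big_split /= -!/(deg _) degl degk degD addr0.
have equiv x : ((m x).+1%:Z %| bernardi_div G (star_tree m l) v e0 (Some x)
      - (bernardi_div G (star_tree m k) v e0 (Some x) + D (Some x)))%Z
   = ((m x).+1%:Z %| (l x)%:Z - (k x)%:Z + leaf_sign v x * D (Some x))%Z.
  have d := rpredB (dl x) (dk x).
  apply/idP/idP => h.
    have := dvdz_mull (- leaf_sign v x) (rpredB h d); congr (_ %| _)%Z.
    rewrite /leaf_sign; move: (bernardi_div _ _ _ _ _) (bernardi_div _ _ _ _ _) => a b.
    move: (bernardi_div _ _ _ _ _) (D _) (k x) (l x) => c f g n; case: ifP => _; lia.
  have := rpredD (dvdz_mull (- leaf_sign v x) h) d; congr (_ %| _)%Z.
  rewrite /leaf_sign; move: (bernardi_div _ _ _ _ _) (bernardi_div _ _ _ _ _) => a b.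
  move: (bernardi_div _ _ _ _ _) (D _) (k x) (l x) => c f g n; case: ifP => _; lia.
rewrite /bernardi_rel star_lin_equivP; split=> [[_ h] x | h].
  by rewrite -equiv.
by split=> // x; rewrite equiv.
Qed.

Lemma star_torsorP kind v D k l : bernardi_check -> deg D = 0 ->
  (torsor G kind v D (star_tree m k) (star_tree m l) <->
   forall x, ((m x).+1%:Z %| (l x)%:Z - (k x)%:Z
     - (if kind is RotorRouting then leaf_sign v x else - leaf_sign v x) * D (Some x))%Z).
Proof.
move=> ok degD; case: kind; first exact: rotor_torsorP.
(* The Bernardi torsor quantifies over starting edges, so an edge at [v] is required to extract the
   congruences. *)
have [e0 inc0] : exists e0, incident G v e0.
  by case: v => [x|]; [exists (spoke m x 0); rewrite incident_leaf side_spoke | exists (spoke m true 0)].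
have rel e0' : incident G v e0' -> _ := fun inc => bernardi_relP k l ok inc degD.
split=> [/(_ e0 inc0)/(rel e0 inc0) h x | h e inc].
  by rewrite mulNr opprK.
by apply/(rel e inc) => x; have := h x; rewrite mulNr opprK.
Qed.

End StarBernardi.

(** The values are the multiplicities less one. *)
Definition mult32 (x : bool) : nat := if x then 2 else 1.
Definition mult61 (x : bool) : nat := if x then 5 else 0.

Lemma bernardi32 : bernardi_check mult32.
Proof. by vm_compute. Qed.

Lemma bernardi61 : bernardi_check mult61.
Proof. by vm_compute. Qed.

(** * Genus *)

Section FaceCount.
Variable (T : finType) (f : T -> T).

(** A root is picked from the set of points reachable from its argument, and on a cycle that set is
    the cycle itself. *)
Lemma root_fcycle p x y : fcycle f p -> x \in p -> y \in p ->
  fingraph.root (frel f) x = fingraph.root (frel f) y.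
Proof.
move=> cp xp yp; have same : connect (frel f) x =1 connect (frel f) y.
  by move=> z; rewrite [LHS](fconnect_cycle cp xp) [RHS](fconnect_cycle cp yp).
rewrite /fingraph.root (eq_pick same); case: pickP => // no.
by have := no y; rewrite connect0.
Qed.

(** A pair [(y, n)] stands for the cycle of [n.+1] points from [y]. Every root in [a] lies on a
    listed cycle, hence is the root of its first point. *)
Lemma fcard_le_cycles (a : {pred T}) (s : seq (T * nat)) :
  all (fun xn => fcycle f (traject f xn.1 xn.2.+1)) s ->
  (forall x, x \in a -> has (fun xn => x \in traject f xn.1 xn.2.+1) s) ->
  (fcard f a <= size s)%N.
Proof.
move=> /allP cs cover; rewrite -(size_map (fun xn => fingraph.root (frel f) xn.1) s).
apply: leq_trans (card_size _); apply/subset_leq_card/subsetP => x.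
rewrite !inE => /andP[/eqP rx /cover/hasP[[y n] yns xn]].
apply/mapP; exists (y, n) => //.
by rewrite -(root_fcycle (cs _ yns) xn (mem_head y _)) rx.
Qed.

(** The root of [x] is reachable from [x], so it lies on the cycle and thus in [a]. *)
Lemma fcard_gt0_cycle (a : {pred T}) x n : fcycle f (traject f x n.+1) ->
  all a (traject f x n.+1) -> (0 < fcard f a)%N.
Proof.
move=> cp /allP pa; apply/card_gt0P; exists (fingraph.root (frel f) x).
have xp : x \in traject f x n.+1 by apply: mem_head.
have rp : fingraph.root (frel f) x \in traject f x n.+1.
  by rewrite -(fconnect_cycle cp xp); apply: connect_root.
by rewrite !inE [_ \in a](pa _ rp) andbT; apply/eqP; apply: root_fcycle cp rp xp.
Qed.

End FaceCount.

Lemma genus_star m : genus (star m) = ((m true + m false).+1 - cyc (star m))./2.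
Proof.
by rewrite /genus card_star_edge card_option card_bool; congr _./2; lia.
Qed.

Lemma cyc32_gt0 : (0 < cyc (star mult32))%N.
Proof. by apply: (@fcard_gt0_cycle _ _ _ (spoke _ true 0, None) 7); vm_compute. Qed.

Lemma cyc61_le2 : (cyc (star mult61) <= 2)%N.
Proof.
(* Two faces, of 6 and 8 darts, exhaust the 14 darts. *)
pose s := [:: ((spoke mult61 true 0, None : option bool), 5%N); ((spoke mult61 true 1, None), 7%N)].
apply: (@fcard_le_cycles _ _ _ s); first by vm_compute.
case=> e u eu.
have /allP/(_ e (mem_star_edges e))/allP/(_ u) : all (fun e => all (fun u => darts (star mult61) (e, u) ==>
    has (fun xn => (e, u) \in traject (facemap (star mult61)) xn.1 xn.2.+1) s)
    [:: None; Some true; Some false]) (star_edges mult61) by vm_compute.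
by move/(_ _)/implyP; apply => //; case: u {eu} => [[]|].
Qed.

(** With at least one face the first genus is at most 3/2, hence at most 1; with at most two faces
    the second is at least (6 - 2)/2 = 2. *)
Lemma genus_star_neq : genus (star mult32) <> genus (star mult61).
Proof.
rewrite !genus_star; have := cyc32_gt0; have := cyc61_le2.
by move: (cyc _) (cyc _) => a b /=; lia.
Qed.

(** * The comparison of the two stars *)

Definition leaves : {set option bool} := [set~ None].

Lemma supported_leaves D : supported leaves D -> D None = 0.
Proof. by apply; rewrite !inE. Qed.

(** The Bezout identity splits the chips of the center into multiples of the two multiplicities,
    which can move to the leaves within the class. *)
Lemma coprime_star_leaves m (s t : int) : s * (m true).+1%:Z + t * (m false).+1%:Z = 1 ->
  forall D, deg D = 0 -> exists D', supported leaves D' /\ lin_equiv (star m) D D'.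
Proof.
move=> st D degD; pose n := D None.
exists (fun u => match u with None => 0 | Some true => D (Some true) + n * s * (m true).+1%:Z
  | Some false => D (Some false) + n * t * (m false).+1%:Z end).
split; first by case=> [x|] //; rewrite !inE.
apply/star_lin_equivP; split.
  rewrite !(deg_star _ true) /= -/n.
  have : n = n * s * (m true).+1%:Z + n * t * (m false).+1%:Z.
    by rewrite -!mulrA -mulrDr st mulr1.
  by move: (n * s * _) (n * t * _) => a b ->; lia.
by case; rewrite opprD addrA subrr add0r rpredN dvdz_mull ?dvdzz.
Qed.

(** Here the counts at the two leaves are opposite, so either side says that the difference at one
    leaf is divisible by 6. *)
Lemma leaves_equiv32 D1 D2 : deg D1 = 0 -> deg D2 = 0 ->
  supported leaves D1 -> supported leaves D2 ->
  (lin_equiv (star mult32) D1 D2 <-> lin_equiv (star mult61) D1 D2).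
Proof.
move=> d1 d2 /supported_leaves s1 /supported_leaves s2.
have e D : deg D = 0 -> D None = 0 -> D (Some false) = - D (Some true).
  by rewrite (deg_star D true) => + D0; rewrite D0 add0r => /eqP; rewrite addrC addr_eq0 => /eqP.
rewrite !star_lin_equivP d1 d2; split=> -[_ dvd]; split=> // x;
  move: (dvd true) (dvd false); rewrite (e D1) // (e D2) //=;
  case: x; rewrite /= ?(e D1) ?(e D2) //; move: (D1 _) (D2 _) => a b; lia.
Qed.

(** By the Chinese remainder theorem one number gives both indices. *)
Lemma tree32P T : spanning_tree (star mult32) T <-> exists n, T = star_tree mult32 (fun=> n).
Proof.
rewrite star_spanning_treeP; split=> [[k ->] | [n ->]]; last by exists (fun=> n).
exists (chinese 3 2 (k true) (k false)); apply/eq_star_treeP.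
by case; rewrite /= ?chinese_modl ?chinese_modr.
Qed.

Lemma tree61P T : spanning_tree (star mult61) T <-> exists n, T = star_tree mult61 (fun=> n).
Proof.
rewrite star_spanning_treeP; split=> [[k ->] | [n ->]]; last by exists (fun=> n).
by exists (k true); apply/eq_star_treeP; case; rewrite //= !modn1.
Qed.

(* Inverse of [Z/6 -> Z/3 x Z/2] on tree indices. *)
Definition crt_tree (T : {set edge (star mult32)}) : {set edge (star mult61)} :=
  [set e : star_edge mult61 | side e ==>
     (spoke mult32 true (idx e) \in T) && (spoke mult32 false (idx e) \in T)].

(** Agreement with [n] modulo 3 and modulo 2 is agreement modulo 6; the single spoke at the other
    leaf belongs to every tree. *)
Lemma crt_treeE n : crt_tree (star_tree mult32 (fun=> n)) = star_tree mult61 (fun=> n).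
Proof.
apply/setP=> e; rewrite in_star_tree inE !spoke_in_star_tree -[X in _ = (X == _)](@spoke_idx _ e (side e)) //.
by rewrite spoke_eq; case: (side e); rewrite /= ?modn1 // -chinese_remainder.
Qed.

Lemma crt_tree_bijection : tree_bijection crt_tree.
Proof.
split; last split.
- by move=> T /tree32P[n ->]; rewrite crt_treeE; apply/tree61P; exists n.
- move=> T1 T2 /tree32P[n1 ->] /tree32P[n2 ->]; rewrite !crt_treeE.
  move/eq_star_treeP/(_ true) => eq_n; apply/eq_star_treeP => x; move: eq_n.
  by case: x => /=; lia.
move=> T' /tree61P[n ->]; exists (star_tree mult32 (fun=> n)); last exact: crt_treeE.
by apply/tree32P; exists n.
Qed.

Theorem theorem1p6 (k : torsor_kind) :
  exists (V : finType) (G G' : ribbon_graph V) (Vgen : {set V})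
         (phi : {set edge G} -> {set edge G'}),
    is_ribbon_graph G /\ is_ribbon_graph G' /\ genus G <> genus G' /\
    property1 G G' Vgen /\ property2 G G' Vgen /\ tree_bijection phi /\
    forall (v : V) (D D' : V -> int) (T T' : {set edge G}),
      deg D = 0 -> supported Vgen D' -> lin_equiv G D' D ->
      spanning_tree G T -> spanning_tree G T' ->
      (torsor G k v D T T' <-> torsor G' k v D' (phi T) (phi T')).
Proof.
exists (option bool : finType), (star mult32), (star mult61), leaves, crt_tree.
split; first exact: star_ribbon.
split; first exact: star_ribbon.
split; first exact: genus_star_neq.
(* The Bezout identities are 3 - 2 = 1 and 0 * 6 + 1 = 1. *)
split; first by split; [apply: (@coprime_star_leaves _ 1 (-1)) | apply: (@coprime_star_leaves _ 0 1)].
split; first exact: leaves_equiv32.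
split; first exact: crt_tree_bijection.
move=> v D D' T T' degD /supported_leaves D'N /star_lin_equivP[degD' dvd].
move=> /tree32P[n ->] /tree32P[n' ->]; rewrite !crt_treeE.
move: (degD'); rewrite degD => degD'0.
rewrite (star_torsorP _ _ _ _ bernardi32 degD) (star_torsorP _ _ _ _ bernardi61 degD'0).
move: degD'0; rewrite (deg_star _ true) D'N /= => degD'0.
move: (dvd true) (dvd false) => /= dt df.
have D'f : D' (Some false) = - D' (Some true) by move: degD'0; lia.
(* The first coordinate carries the same sign in both graphs. Modulo 2 signs do not matter, so the
   conditions modulo 3 and 2 for [D] combine into the one modulo 6 for [D']. *)
rewrite D'f in df; split=> h x; move: (h true) (h false) dt df;
  rewrite /leaf_sign /mult32 /mult61 ?D'f.
  case: x; case: k {h}; case: eqP => ?; case: eqP => ? /=; rewrite ?D'f; move: (D _) (D _) (D' _) => a b c; lia.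
case: x; case: k {h}; case: eqP => ?; case: eqP => ? /=; move: (D _) (D _) (D' _) => a b c; lia.
Qed.
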